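(* For every odd integer $k\ge 3$, the flower snark $F_k$ satisfies $\tau(F_k)=4$.
   Context: For odd $k\ge 3$, the flower snark $F_k$ is the cubic graph on the $4k$ vertices $x_0,\ldots,x_{k-1}$, $y_0,\ldots,y_{k-1}$, $z_0,\ldots,z_{k-1}$, $t_0,\ldots,t_{k-1}$ such that $x_0x_1\cdots x_{k-1}$ is an induced cycle of length $k$, $y_0y_1\cdots y_{k-1}z_0z_1\cdots z_{k-1}$ is an induced cycle of length $2k$, and for each $i=0,\ldots,k-1$ the vertex $t_i$ is adjacent to $x_i$, $y_i$ and $z_i$. For a bridgeless cubic graph $G$, the perfect matching index $\tau(G)$ is the minimum number of perfect matchings of $G$ whose union is $E(G)$. *)

(* Defs.v *)
From HB Require Import structures.
From mathcomp Require Import all_boot.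

Set Implicit Arguments.
Unset Strict Implicit.
Unset Printing Implicit Defensive.

(* A finite simple graph is a symmetric irreflexive relation on a finType;
   edges are its two-element vertex sets. *)
Definition edges (V : finType) (e : rel V) : {set {set V}} :=
  [set [set u; v] | u in V, v in V & e u v].

Definition perfect_matching (V : finType) (e : rel V) (M : {set {set V}}) :
    bool :=
  (M \subset edges e) && [forall v, #|[set f in M | v \in f]| == 1].

Definition perfect_matching_cover (V : finType) (e : rel V)
    (C : {set {set {set V}}}) : bool :=
  [forall (M | M \in C), perfect_matching e M] &&
  (\bigcup_(M in C) M == edges e).

(* tau(e) = n, as a relation: this avoids a junk value for graphs with an edge
   that lies in no perfect matching, where the minimum does not exist.  Covers
   are sets, not families, of matchings: repetitions never help to minimise. *)
Definition is_perfect_matching_index (V : finType) (e : rel V) (n : nat) :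
    Prop :=
  (exists2 C : {set {set {set V}}}, perfect_matching_cover e C & #|C| = n) /\
  (forall C : {set {set {set V}}}, perfect_matching_cover e C -> n <= #|C|).

Inductive flower_part : Type := Fx | Fy | Fz | Ft.

Definition flower_part_code (p : flower_part) : bool * bool :=
  match p with
  | Fx => (false, false)
  | Fy => (false, true)
  | Fz => (true, false)
  | Ft => (true, true)
  end.

Definition flower_part_decode (c : bool * bool) : flower_part :=
  match c with
  | (false, false) => Fx
  | (false, true) => Fy
  | (true, false) => Fz
  | (true, true) => Ft
  end.

Lemma flower_part_codeK : cancel flower_part_code flower_part_decode.
Proof. by case. Qed.

HB.instance Definition _ := Finite.copy flower_part (can_type flower_part_codeK).

(* (Fx, i), (Fy, i), (Fz, i), (Ft, i) stand for x_i, y_i, z_i, t_i. *)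
Definition flower_vertex (k : nat) : finType := (flower_part * 'I_k)%type.

(* An orientation of the edges: x_i -> x_{i+1 mod k}; y_i -> y_{i+1} and
   z_i -> z_{i+1} without wrap-around; y_{k-1} -> z_0 and z_{k-1} -> y_0;
   t_i -> x_i, y_i, z_i. *)
Definition flower_arc (k : nat) (u v : flower_vertex k) : bool :=
  let i : nat := u.2 in
  let j : nat := v.2 in
  match u.1, v.1 with
  | Fx, Fx => j == i.+1 %% k
  | Fy, Fy | Fz, Fz => j == i.+1
  | Fy, Fz | Fz, Fy => (i.+1 == k) && (j == 0)
  | Ft, Fx | Ft, Fy | Ft, Fz => i == j
  | _, _ => false
  end.

Definition flower_snark (k : nat) : rel (flower_vertex k) :=
  fun u v => flower_arc u v || flower_arc v u.
Arguments flower_snark k u v : clear implicits.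

Lemma flower_snark_sym (k : nat) : symmetric (flower_snark k).
Proof. by move=> u v; rewrite /flower_snark orbC. Qed.

Lemma flower_snark_irrefl (k : nat) : 1 < k -> irreflexive (flower_snark k).
Proof.
move=> k_gt1 [p i]; rewrite /flower_snark orbb /flower_arc /=.
case: p => //; rewrite ?(ltn_eqF (ltnSn _)) //.
have := ltn_ord i; rewrite leq_eqVlt => /orP[/eqP iS|iS]; last first.
  by rewrite modn_small // ltn_eqF.
by rewrite iS modnn; apply/eqP => i0; rewrite -iS i0 in k_gt1.
Qed.

(* Main.v *)
(* Call {x_i, y_i, z_i, t_i} the slice i.  A perfect matching pairs t_i with one
   rim vertex of its slice, so the cuts on both sides of a slice carry exactly
   two matching edges together; going around an odd number of slices, each cut
   carries exactly one.  Perfect matchings thus correspond to words p_0 ... p_k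
   over {x, y, z} with distinct consecutive letters, where p_k is p_0 with y and
   z exchanged.  Three matchings covering all edges would give a permutation of
   {x, y, z} at each cut; consecutive ones differ by a derangement, hence have
   the same parity, while closing up applies a transposition.  Four suitable
   words, alternating between two letters except at the end, do cover. *)

Require Import Defs.
From mathcomp Require Import all_boot.
From mathcomp Require Import zify.

Set Implicit Arguments.
Unset Strict Implicit.
Unset Printing Implicit Defensive.

(** * Perfect matchings as edge-respecting involutions *)

Lemma set2_eqP (T : finType) (a b c d : T) :
  [set a; b] = [set c; d] -> (a = c /\ b = d) \/ (a = d /\ b = c).
Proof.
move=> E.
have: (a \in [set c; d]) && (b \in [set c; d]) by rewrite -E set21 set22.
have: (c \in [set a; b]) && (d \in [set a; b]) by rewrite E set21 set22.
rewrite !inE => /andP[/orP[]/eqP-> /orP[]/eqP->] /andP[/orP[]/eqP E1 /orP[]/eqP E2];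
  by subst; auto.
Qed.

Lemma mem_edges (V : finType) (e : rel V) (u v : V) :
  symmetric e -> ([set u; v] \in edges e) = e u v.
Proof.
move=> e_sym; apply/imset2P/idP => [[a b _]|e_uv]; last first.
  by exists u v; rewrite ?inE.
by rewrite inE => /andP[_ e_ab] /set2_eqP[[-> ->]|[-> ->]] //; rewrite e_sym.
Qed.

Definition mating (V : finType) (e : rel V) (f : V -> V) : Prop :=
  (forall u, e u (f u)) /\ involutive f.

(** The default [v] is never reached when [M] is a perfect matching of an irreflexive symmetric
    relation. *)
Definition mate (V : finType) (M : {set {set V}}) (v : V) : V :=
  odflt v [pick w | (w != v) && ([set v; w] \in M)].

Lemma mateE (V : finType) (e : rel V) (M : {set {set V}}) (u v : V) :
  symmetric e -> irreflexive e -> perfect_matching e M ->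
  ([set u; v] \in M) = (mate M u == v).
Proof.
move=> e_sym e_irr /andP[/subsetP sub_M /forallP/(_ u)/cards1P[f def_f]].
have edge_ff w : [set u; w] \in M -> [set u; w] = f.
  by move=> Mw; apply/set1P; rewrite -def_f inE Mw set21.
have edge_neq w : [set u; w] \in M -> w != u.
  by move=> /sub_M; rewrite mem_edges //; apply: contraTneq => ->; rewrite e_irr.
have edge_inj w1 w2 : [set u; w1] \in M -> [set u; w2] \in M -> w1 = w2.
  move=> M1 M2; have := edge_ff _ M1; rewrite -(edge_ff _ M2).
  by case/set2_eqP => [[]|[-> ->]].
have [w Mw] : exists w, [set u; w] \in M.
  have: f \in [set f] by rewrite set11.
  rewrite -def_f inE => /andP[Mf]; have /sub_M/imset2P[a b _ _ Ef] := Mf.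
  rewrite Ef !inE => /orP[]/eqP ->; first by exists b; rewrite -Ef.
  by exists a; rewrite setUC -Ef.
have Mmate : [set u; mate M u] \in M.
  rewrite /mate; case: pickP => [x /andP[] //|/(_ w)].
  by rewrite Mw edge_neq.
by apply/idP/eqP => [Mv|<-//]; apply: edge_inj.
Qed.

Lemma mate_mating (V : finType) (e : rel V) (M : {set {set V}}) :
  symmetric e -> irreflexive e -> perfect_matching e M -> mating e (mate M).
Proof.
move=> e_sym e_irr pM; have memM u v := @mateE V e M u v e_sym e_irr pM.
have Mmate u : [set u; mate M u] \in M by rewrite memM.
split=> u; last by apply/eqP; rewrite -memM setUC.
by rewrite -mem_edges //; case/andP: pM => /subsetP sub _; apply: sub.
Qed.

Definition matching_of (V : finType) (f : V -> V) : {set {set V}} :=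
  [set [set u; f u] | u : V].

Lemma matching_of_perfect (V : finType) (e : rel V) (f : V -> V) :
  symmetric e -> mating e f -> perfect_matching e (matching_of f).
Proof.
move=> e_sym [e_f fK]; apply/andP; split.
  by apply/subsetP => _ /imsetP[u _ ->]; rewrite mem_edges.
apply/forallP => v; apply/cards1P; exists [set v; f v]; apply/setP => g.
rewrite !inE; apply/andP/eqP => [[/imsetP[u _ ->]]|->]; last first.
  by split; [apply: imset_f | rewrite set21].
by rewrite !inE => /orP[]/eqP -> //; rewrite fK setUC.
Qed.

Lemma matings_cover (V I : finType) (e : rel V) (F : I -> V -> V) :
  symmetric e -> (forall i, mating e (F i)) ->
  (forall u v, e u v -> exists i, F i u = v) ->
  perfect_matching_cover e [set matching_of (F i) | i : I].
Proof.
move=> e_sym mF covF; apply/andP; split.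
  by apply/forall_inP => _ /imsetP[i _ ->]; apply: matching_of_perfect.
rewrite eqEsubset; apply/andP; split.
  apply/bigcupsP => _ /imsetP[i _ ->].
  by case/andP: (matching_of_perfect e_sym (mF i)).
apply/subsetP => g /imset2P[u v _]; rewrite inE => /andP[_ e_uv] ->.
have [i <-] := covF u v e_uv.
by apply/bigcupP; exists (matching_of (F i)); apply: imset_f.
Qed.

Lemma cover_three_matings (V : finType) (e : rel V)
    (C : {set {set {set V}}}) (u0 v0 : V) :
  symmetric e -> irreflexive e -> e u0 v0 ->
  perfect_matching_cover e C -> #|C| <= 3 ->
  exists f g h, [/\ mating e f, mating e g, mating e h &
    forall u v, e u v -> [|| f u == v, g u == v | h u == v]].
Proof.
move=> e_sym e_irr e_uv0 /andP[/forall_inP perfC /eqP covC] leC3.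
have covered u v : e u v -> exists2 M, M \in C & mate M u = v.
  rewrite -mem_edges // -covC => /bigcupP[M CM].
  by rewrite (@mateE V e) ?perfC // => /eqP; exists M.
have [M0 CM0 _] := covered _ _ e_uv0.
(* A cover with fewer than three matchings is padded with copies of [M0], which exists because the
   edge [u0 v0] is covered. *)
pose N i := nth M0 (enum C) i.
have mN i : mating e (mate (N i)).
  apply: mate_mating => //; apply: perfC; rewrite /N.
  have [lt_i|ge_i] := ltnP i (size (enum C)); last by rewrite nth_default.
  by rewrite -mem_enum mem_nth.
exists (mate (N 0)), (mate (N 1)), (mate (N 2)); split=> // u v /covered[M].
rewrite -mem_enum => /(nthP M0)[i]; rewrite -cardE => lt_i.
rewrite -/(N i) => <- <-; have := leq_trans lt_i leC3.
by case: i {lt_i} => [|[|[|i]]] //= _; rewrite eqxx ?orbT.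
Qed.

(** * Left and right neighbours in the flower snark *)

Definition twist (b : bool) (r : flower_part) : flower_part :=
  if b then match r with Fy => Fz | Fz => Fy | _ => r end else r.

Lemma twistK (b : bool) : involutive (twist b).
Proof. by case: b => -[]. Qed.

Lemma twist_Ft (b : bool) (r : flower_part) : (twist b r == Ft) = (r == Ft).
Proof. by case: b; case: r. Qed.

Lemma ordS_eq0 (k : nat) (i : 'I_k) : (ordS i == 0 :> nat) = (i.+1 == k).
Proof.
rewrite /=; have := ltn_ord i; rewrite leq_eqVlt => /orP[/eqP->|lt_i].
  by rewrite modnn !eqxx.
by rewrite modn_small // (ltn_eqF lt_i).
Qed.

Lemma ordS_small (k : nat) (i : 'I_k) : i.+1 < k -> ordS i = i.+1 :> nat.
Proof. by move=> lt_i; rewrite /= modn_small. Qed.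

Lemma ordS_ind (k : nat) (k_gt0 : 0 < k) (P : 'I_k -> Prop) :
  P (Ordinal k_gt0) -> (forall i : 'I_k, i.+1 < k -> P i -> P (ordS i)) ->
  forall i, P i.
Proof.
move=> P0 PS [n lt_n]; elim: n lt_n => [|n IHn] lt_n.
  by rewrite (_ : Ordinal lt_n = Ordinal k_gt0) //; apply: val_inj.
have := PS (Ordinal (ltnW lt_n)) lt_n (IHn _).
by congr P; apply: val_inj; rewrite /= modn_small.
Qed.

(** The twist sits at the seam between slices k-1 and 0. Centres are moved too, although they are
    not adjacent to each other, so that [right_nbr] and [left_nbr] are inverse bijections. *)
Definition right_nbr (k : nat) (u : flower_vertex k) : flower_vertex k :=
  (twist (u.2.+1 == k) u.1, ordS u.2).

Definition left_nbr (k : nat) (u : flower_vertex k) : flower_vertex k :=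
  (twist (u.2 == 0 :> nat) u.1, ord_pred u.2).

Lemma right_nbrK (k : nat) : cancel (@right_nbr k) (@left_nbr k).
Proof.
by case=> r i; rewrite /left_nbr /right_nbr -ordS_eq0 /= twistK ordSK.
Qed.

Lemma left_nbrK (k : nat) : cancel (@left_nbr k) (@right_nbr k).
Proof.
by case=> r i; rewrite /left_nbr /right_nbr -ordS_eq0 ord_predK /= twistK.
Qed.

Lemma flower_arcE (k : nat) (u v : flower_vertex k) :
  flower_arc u v =
  if u.1 == Ft then (v.1 != Ft) && (v.2 == u.2) else v == right_nbr u.
Proof.
case: u v => r i [q j]; rewrite /flower_arc /right_nbr /=.
have [ri|ri] := boolP (r == Ft); first by case: r ri; case: q; rewrite //= eq_sym.
rewrite xpair_eqE; have := ltn_ord j; have := ltn_ord i.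
rewrite leq_eqVlt -(inj_eq val_inj) /= => /orP[iK|lt_i] lt_j.
  by case: r ri; case: q; rewrite //= iK ?(eqP iK) ?modnn ?(ltn_eqF lt_j).
by case: r ri; case: q; rewrite //= (ltn_eqF lt_i) ?modn_small.
Qed.

Lemma flower_snark_t (k : nat) (i : 'I_k) (v : flower_vertex k) :
  flower_snark k (Ft, i) v = (v.1 != Ft) && (v.2 == i).
Proof.
rewrite /flower_snark !flower_arcE eqxx /=.
have [v_t|v_t] := boolP (v.1 == Ft); first by [].
suff /negPf-> : (Ft, i) != right_nbr v by rewrite orbF.
apply: contraNneq v_t => E.
by rewrite -(twist_Ft (v.2.+1 == k)) -[twist _ _]/((right_nbr v).1) -E.
Qed.

Lemma flower_snark_rim (k : nat) (u v : flower_vertex k) : u.1 != Ft ->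
  flower_snark k u v =
  [|| v == (Ft, u.2), v == left_nbr u | v == right_nbr u].
Proof.
case: u => r i /= r_t; rewrite /flower_snark !flower_arcE (negPf r_t) /=.
rewrite orbA orbC; congr (_ || _).
have -> : (v == left_nbr (r, i)) = ((r, i) == right_nbr v).
  by rewrite eq_sym -(can_eq (@right_nbrK k)) left_nbrK.
(* Arcs into a rim vertex come from the centre of its slice or from its left neighbour; the two
   cases are separated by whether [v] is a centre. *)
have [/eqP v_t|v_t] := boolP (v.1 == Ft); last first.
  suff /negPf-> : v != (Ft, i) by [].
  by apply: contraNneq v_t => ->.
suff /negPf-> : (r, i) != right_nbr v.
  by case: v v_t => q j /= ->; rewrite orbF eq_sym; apply/eqP/eqP => [->|[]].
by apply: contraNneq r_t => -[-> _]; rewrite twist_Ft v_t.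
Qed.

Lemma left_right_neq (k : nat) (u : flower_vertex k) :
  3 <= k -> left_nbr u != right_nbr u.
Proof.
(* Shifting both slice indices by one compares i with i+2 modulo k, which differ as k is at least
   3. *)
case: u => r i k_ge3; apply/eqP => /(congr1 (fun v => ordS v.2)).
rewrite [LHS]ord_predK => /(congr1 val) /=; have := ltn_ord i.
rewrite leq_eqVlt => /orP[/eqP Ek|lt1].
  by rewrite Ek modnn modn_small; lia.
rewrite (modn_small lt1); move: (lt1); rewrite leq_eqVlt => /orP[/eqP Ek|lt2].
  by rewrite Ek modnn; lia.
by rewrite modn_small //; lia.
Qed.

(** * Matching edges in the cuts between consecutive slices *)

(** Cut [i] lies to the left of slice [i], and its edges are named by their ends in that slice. *)
Definition cut_edge (k : nat) (f : flower_vertex k -> flower_vertex k)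
    (i : 'I_k) (r : flower_part) : bool :=
  f (r, i) == left_nbr (r, i).

Definition cut_size (k : nat) (f : flower_vertex k -> flower_vertex k)
    (i : 'I_k) : nat :=
  cut_edge f i Fx + cut_edge f i Fy + cut_edge f i Fz.

(** The same edge is seen from its two ends; its name changes only at the seam. *)
Lemma cut_edge_ordS (k : nat) (f : flower_vertex k -> flower_vertex k)
    (i : 'I_k) (r : flower_part) : involutive f ->
  cut_edge f (ordS i) (twist (i.+1 == k) r) = (f (r, i) == right_nbr (r, i)).
Proof.
move=> fK; rewrite /cut_edge -[(_, _)]/(right_nbr (r, i)) right_nbrK.
by rewrite -{2}[(r, i)]fK (can_eq fK) eq_sym.
Qed.

Lemma mating_t (k : nat) (f : flower_vertex k -> flower_vertex k) (i : 'I_k) :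
  mating (flower_snark k) f -> exists2 r, r != Ft & f (Ft, i) = (r, i).
Proof.
case=> f_e _; have := f_e (Ft, i); rewrite flower_snark_t => /andP[r_t /eqP Ei].
by exists (f (Ft, i)).1; rewrite // -{3}Ei; case: (f _).
Qed.

(* The centre t_i has its mate in slice i; the two other rim vertices of the
   slice are matched across the two neighbouring cuts. *)
Lemma cut_size_ordS (k : nat) (f : flower_vertex k -> flower_vertex k)
    (i : 'I_k) : 3 <= k -> mating (flower_snark k) f ->
  cut_size f i + cut_size f (ordS i) = 2.
Proof.
move=> k_ge3 mf; have [f_e fK] := mf; have [r0 r0_t fr0] := mating_t i mf.
have one r : r != Ft -> (r == r0) + cut_edge f i r +
    cut_edge f (ordS i) (twist (i.+1 == k) r) = 1.
  move=> r_t; rewrite cut_edge_ordS // /cut_edge.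
  have -> : (r == r0) = (f (r, i) == (Ft, i)).
    by rewrite -[(Ft, i)]fK (can_eq fK) fr0 xpair_eqE eqxx andbT.
  have lt : left_nbr (r, i) != (Ft, i).
    by apply: contraNneq r_t => -[/eqP]; rewrite twist_Ft.
  have rt : right_nbr (r, i) != (Ft, i).
    by apply: contraNneq r_t => -[/eqP]; rewrite twist_Ft.
  have lr := left_right_neq (r, i) k_ge3.
  have := f_e (r, i); rewrite flower_snark_rim // => /or3P[]/eqP-> /=.
  - by rewrite eqxx ![(Ft, i) == _]eq_sym (negPf lt) (negPf rt).
  - by rewrite eqxx (negPf lt) (negPf lr).
  - by rewrite eqxx (negPf rt) eq_sym (negPf lr).
have := one Fx isT; have := one Fy isT; have := one Fz isT.
rewrite /cut_size.
by case: (i.+1 == k) => /=; case: r0 r0_t {fr0 one} => //= _; lia.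
Qed.

(** Cut sizes alternate between c and 2 - c. As k-1 is even, cuts k-1 and 0 both have size c, and
    being consecutive they add up to 2. *)
Lemma cut_size1 (k : nat) (f : flower_vertex k -> flower_vertex k) (i : 'I_k) :
  odd k -> 3 <= k -> mating (flower_snark k) f -> cut_size f i = 1.
Proof.
move=> k_odd k_ge3 mf; have k_gt0 : 0 < k by lia.
have cS j := cut_size_ordS j k_ge3 mf.
set i0 := Ordinal k_gt0; pose c0 := cut_size f i0.
have alt j : cut_size f j = if odd j then 2 - c0 else c0.
  elim/(@ordS_ind k k_gt0): j => // j lt_j.
  have := cS j; have := cS i0; rewrite -/c0 (ordS_small lt_j) /=.
  by case: (odd j) => /=; lia.
have lt_k : k.-1 < k by lia.
have := cS (Ordinal lt_k); have -> : ordS (Ordinal lt_k) = i0.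
  by apply: val_inj; rewrite /= prednK // modnn.
have k1_even : odd k.-1 = false by lia.
by rewrite !alt /= k1_even; case: odd; lia.
Qed.

Definition crossing (k : nat) (f : flower_vertex k -> flower_vertex k)
    (i : 'I_k) : flower_part :=
  if cut_edge f i Fx then Fx else if cut_edge f i Fy then Fy else Fz.

Lemma crossing_Ft (k : nat) (f : flower_vertex k -> flower_vertex k) (i : 'I_k) :
  crossing f i != Ft.
Proof. by rewrite /crossing; case: ifP => //; case: ifP. Qed.

Lemma crossingE (k : nat) (f : flower_vertex k -> flower_vertex k) (i : 'I_k)
    (r : flower_part) : odd k -> 3 <= k -> mating (flower_snark k) f ->
  r != Ft -> cut_edge f i r = (r == crossing f i).
Proof.
move=> k_odd k_ge3 mf; have := cut_size1 i k_odd k_ge3 mf.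
rewrite /cut_size /crossing; case: r => //.
all: by do 3![case: (cut_edge f i _) => //].
Qed.

(** The twist renames the letter of the next cut as seen from slice [i]. Equal letters would match
    one rim vertex both to the left and to the right. *)
Lemma crossing_ordS (k : nat) (f : flower_vertex k -> flower_vertex k)
    (i : 'I_k) : odd k -> 3 <= k -> mating (flower_snark k) f ->
  twist (i.+1 == k) (crossing f (ordS i)) != crossing f i.
Proof.
move=> k_odd k_ge3 mf; have [f_e fK] := mf.
have p_t := crossing_Ft f (ordS i).
set r := twist _ _; have r_t : r != Ft by rewrite twist_Ft.
rewrite -crossingE //; apply/negP => /eqP fl.
have := crossingE (ordS i) k_odd k_ge3 mf p_t.
rewrite eqxx -{1}[crossing _ _](twistK (i.+1 == k)) -/r cut_edge_ordS // fl.
by rewrite (negPf (left_right_neq _ k_ge3)).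
Qed.

(** * Lower bound: parity of the letters used by three matchings *)

Definition even_triple (p q r : flower_part) : bool :=
  (p, q, r) \in [:: (Fx, Fy, Fz); (Fy, Fz, Fx); (Fz, Fx, Fy)].

Definition rim_triple (p q r : flower_part) : bool :=
  all (fun s => s \in [:: p; q; r]) [:: Fx; Fy; Fz].

Lemma even_triple_twist (b : bool) (p q r : flower_part) :
  rim_triple p q r ->
  even_triple (twist b p) (twist b q) (twist b r) = even_triple p q r (+) b.
Proof. by case: b; case: p; case: q; case: r. Qed.

Lemma rim_triple_twist (b : bool) (p q r : flower_part) :
  rim_triple (twist b p) (twist b q) (twist b r) = rim_triple p q r.
Proof. by case: b; case: p; case: q; case: r. Qed.

(* Two permutations of three letters that differ everywhere differ by a
   3-cycle. *)
Lemma even_triple_derange (p q r p' q' r' : flower_part) :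
  rim_triple p q r -> rim_triple p' q' r' ->
  p' != p -> q' != q -> r' != r -> even_triple p' q' r' = even_triple p q r.
Proof.
by case: p; case: q; case: r => // _; case: p'; case: q'; case: r'.
Qed.

Lemma three_matings_nocover (k : nat)
    (f g h : flower_vertex k -> flower_vertex k) : odd k -> 3 <= k ->
  mating (flower_snark k) f -> mating (flower_snark k) g ->
  mating (flower_snark k) h ->
  (forall u v, flower_snark k u v -> [|| f u == v, g u == v | h u == v]) ->
  False.
Proof.
move=> k_odd k_ge3 mf mg mh cov; have k_gt0 : 0 < k by lia.
(* Each matching uses one edge of a cut, and all three edges of the cut are covered. *)
have rim i : rim_triple (crossing f i) (crossing g i) (crossing h i).
  have in_rim r : r != Ft ->
      r \in [:: crossing f i; crossing g i; crossing h i].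
    move=> r_t; rewrite !inE -!crossingE //; apply: cov.
    by rewrite flower_snark_rim // eqxx orbT.
  by rewrite /rim_triple /= !in_rim.
pose ev i := even_triple (crossing f i) (crossing g i) (crossing h i).
have evS i : ev (ordS i) = ev i (+) (i.+1 == k).
  (* The letters of the next cut, read from slice [i], form a derangement of the current ones;
     undoing the renaming flips the parity exactly at the seam. *)
  rewrite /ev -(@even_triple_derange (crossing f i) (crossing g i)
    (crossing h i) (twist (i.+1 == k) (crossing f (ordS i)))
    (twist (i.+1 == k) (crossing g (ordS i)))
    (twist (i.+1 == k) (crossing h (ordS i)))) ?crossing_ordS //.
    by rewrite even_triple_twist // -addbA addbb addbF.
  by rewrite rim_triple_twist.
have ev_const i : ev i = ev (Ordinal k_gt0).
  elim/(@ordS_ind k k_gt0): i => // i lt_i <-.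
  by rewrite evS (ltn_eqF lt_i) addbF.
have lt_k : k.-1 < k by lia.
have := evS (Ordinal lt_k); rewrite !ev_const /= prednK // eqxx.
by case: (ev _).
Qed.

(** * From closed words of letters to perfect matchings *)

Definition third (p q : flower_part) : flower_part :=
  if Fx \notin [:: p; q] then Fx else if Fy \notin [:: p; q] then Fy else Fz.

(* The walk [s] visits the rim vertex [s i] of slice i from the left and
   [s i.+1] from the right; the remaining rim vertex is matched with t_i. *)
Definition walk (k : nat) (s : nat -> flower_part) : Prop :=
  [/\ forall n, s n != Ft, forall n, n < k -> s n.+1 != s n
    & s k = twist true (s 0)].

Definition walk_mate (k : nat) (s : nat -> flower_part) (u : flower_vertex k) :
    flower_vertex k :=
  if u.1 == Ft then (third (s u.2) (s u.2.+1), u.2)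
  else if u.1 == s u.2 then left_nbr u
  else if u.1 == s u.2.+1 then right_nbr u
  else (Ft, u.2).

Lemma walk_ordS (k : nat) (s : nat -> flower_part) (i : 'I_k) :
  walk k s -> s (ordS i) = twist (i.+1 == k) (s i.+1).
Proof.
case=> _ _ sk; have := ltn_ord i; rewrite leq_eqVlt => /orP[/eqP Ek|lt_i].
  by rewrite /= Ek modnn eqxx sk twistK.
by rewrite (ordS_small lt_i) (ltn_eqF lt_i).
Qed.

Lemma walk_mate_left (k : nat) (s : nat -> flower_part) (i : 'I_k) :
  walk k s -> walk_mate s (s i, i) = left_nbr (s i, i).
Proof. by case=> s_t _ _; rewrite /walk_mate /= (negPf (s_t i)) eqxx. Qed.

Lemma walk_mate_right (k : nat) (s : nat -> flower_part) (i : 'I_k) :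
  walk k s -> walk_mate s (s i.+1, i) = (s (ordS i), ordS i).
Proof.
move=> ws; have [s_t s_neq _] := ws; rewrite (walk_ordS i ws).
by rewrite /walk_mate /= (negPf (s_t _)) (negPf (s_neq _ _)) ?eqxx.
Qed.

Lemma walk_mating (k : nat) (s : nat -> flower_part) :
  walk k s -> mating (flower_snark k) (walk_mate s).
Proof.
move=> ws; have [s_t s_neq _] := ws.
have third_ok p q : p != Ft -> q != Ft ->
  [/\ third p q != Ft, third p q != p & third p q != q].
  by case: p; case: q.
have third_uniq p q r : p != Ft -> q != Ft -> q != p ->
    r != Ft -> r != p -> r != q -> third p q = r.
  by case: p; case: q; case: r.
split=> [[r i]|[r i]].
  have [->|r_t] := eqVneq r Ft.
    by rewrite flower_snark_t eqxx andbT; case: (third_ok _ _ (s_t i) (s_t i.+1)).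
  rewrite flower_snark_rim // /walk_mate /= (negPf r_t).
  by case: ifP => _; [|case: ifP => _]; rewrite eqxx ?orbT.
have [->|r_t] := eqVneq r Ft.
  have [t1 t2 t3] := third_ok _ _ (s_t i) (s_t i.+1).
  by rewrite /walk_mate /= (negPf t1) (negPf t2) (negPf t3).
have [->|r_l] := eqVneq r (s i).
  (* With [i] written as a successor, the left step from slice [i] is undone by the right step from
     slice [j]. *)
  have [j ->] : exists j, i = ordS j by exists (ord_pred i); rewrite ord_predK.
  rewrite walk_mate_left // {1}(walk_ordS j ws).
  by rewrite -[(twist _ _, _)]/(right_nbr (s j.+1, j)) right_nbrK walk_mate_right.
have [->|r_r] := eqVneq r (s i.+1).
  rewrite walk_mate_right // walk_mate_left // (walk_ordS i ws).
  exact: (right_nbrK (s i.+1, i)).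
rewrite {2}/walk_mate /= (negPf r_t) (negPf r_l) (negPf r_r).
by rewrite /walk_mate /= (third_uniq _ _ r) ?s_t ?s_neq.
Qed.

Lemma walks_cover (k : nat) (I : finType) (S : I -> nat -> flower_part) :
  (forall m, walk k (S m)) ->
  (forall n r, n < k -> r != Ft -> exists m, S m n.+1 = r) ->
  (forall n r, n < k -> r != Ft -> exists m, third (S m n) (S m n.+1) = r) ->
  forall u v, flower_snark k u v -> exists m, walk_mate (S m) u = v.
Proof.
move=> wS cov_cut cov_t.
have cov_arc (u v : flower_vertex k) :
    flower_arc u v -> exists m, walk_mate (S m) u = v.
  case: u v => r i [q j]; rewrite flower_arcE /=.
  case: eqP => [-> /andP[q_t /eqP->]|/eqP r_t /eqP->].
    by have [m <-] := cov_t _ _ (ltn_ord i) q_t; exists m.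
  have [m <-] := cov_cut _ _ (ltn_ord i) r_t.
  by exists m; rewrite walk_mate_right // (walk_ordS i (wS m)).
(* An edge traversed against its arc is covered by the same matching, since [walk_mate] is
   involutive. *)
move=> u v /orP[/cov_arc //|/cov_arc[m <-]]; exists m.
by have [_ ->] := walk_mating (wS m).
Qed.

(** * Upper bound: four words that cover every edge *)

Definition first_letter (m : 'I_4) := nth Ft [:: Fx; Fy; Fy; Fz] m.
Definition second_letter (m : 'I_4) := nth Ft [:: Fz; Fx; Fz; Fy] m.
Definition last_letter (m : 'I_4) := nth Ft [:: Fy; Fy; Fx; Fz] m.

(* The words a b a b ... a b c followed by the twist of a; the letters were
   found by a computer search over the steps of the case k = 3. *)
Definition four_walks (k : nat) (m : 'I_4) (n : nat) : flower_part :=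
  if n < k.-1 then (if odd n then second_letter m else first_letter m)
  else if n == k.-1 then last_letter m else twist true (first_letter m).

(** Only four kinds of consecutive letters occur, whatever k is, so each covering condition reduces
    to a finite check. *)
Variant four_walks_step_spec (k n : nat) : Prop :=
  FourWalksStep (p q : 'I_4 -> flower_part) of
    four_walks k ^~ n =1 p & four_walks k ^~ n.+1 =1 q
  & (p, q) = (first_letter, second_letter) \/
    (p, q) = (second_letter, first_letter) \/
    (p, q) = (second_letter, last_letter) \/
    (p, q) = (last_letter, twist true \o first_letter).

Lemma four_walks_step (k n : nat) :
  odd k -> 3 <= k -> n < k -> four_walks_step_spec k n.
Proof.
move=> k_odd k_ge3 lt_n; rewrite /four_walks.
have [lt1|[En|En]] : n.+1 < k.-1 \/ (n = k.-2 \/ n = k.-1) by lia.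
- case n_odd: (odd n).
    by exists second_letter first_letter; [move=> m..|auto];
      rewrite /four_walks ?lt1 ?(ltnW lt1) /= n_odd.
  by exists first_letter second_letter; [move=> m..|auto];
    rewrite /four_walks ?lt1 ?(ltnW lt1) /= n_odd.
(* Here n = k-2 is odd because k is, so the alternating stretch ends on the second letter. *)
- exists second_letter last_letter; [move=> m..|auto]; rewrite /four_walks.
    have -> : n < k.-1 by lia.
    by have -> : odd n by lia.
  have -> : (n.+1 < k.-1) = false by lia.
  by have -> : n.+1 == k.-1 by lia.
exists last_letter (twist true \o first_letter); [move=> m..|auto 6];
  rewrite /four_walks.
  by rewrite En ltnn eqxx.
have -> : (n.+1 < k.-1) = false by lia.
by have -> : (n.+1 == k.-1) = false by lia.
Qed.

Lemma four_walks_walk (k : nat) (m : 'I_4) :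
  odd k -> 3 <= k -> walk k (four_walks k m).
Proof.
move=> k_odd k_ge3; split=> [n|n lt_n|].
- by rewrite /four_walks; case: m => -[|[|[|[|m]]]] // ? /=;
    case: ifP; case: ifP.
- have [p q -> -> pq] := four_walks_step k_odd k_ge3 lt_n.
  by case: pq => [[-> ->]|[[-> ->]|[[-> ->]|[-> ->]]]];
    case: m => -[|[|[|[|m]]]].
rewrite /four_walks; have -> : 0 < k.-1 by lia.
have -> : (k < k.-1) = false by lia.
by have -> : (k == k.-1) = false by lia.
Qed.

Lemma four_walks_cut (k n : nat) (r : flower_part) :
  odd k -> 3 <= k -> n < k -> r != Ft -> exists m, four_walks k m n.+1 = r.
Proof.
move=> k_odd k_ge3 lt_n r_t; have [p q _ Eq pq] := four_walks_step k_odd k_ge3 lt_n.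
suff [m <-] : exists m, q m = r by exists m; apply: Eq.
case: pq => [[_ ->]|[[_ ->]|[[_ ->]|[_ ->]]]]; case: r r_t => // _;
  first [by exists (@Ordinal 4 0 isT) | by exists (@Ordinal 4 1 isT)
        | by exists (@Ordinal 4 2 isT) | by exists (@Ordinal 4 3 isT)].
Qed.

Lemma four_walks_third (k n : nat) (r : flower_part) :
  odd k -> 3 <= k -> n < k -> r != Ft ->
  exists m, third (four_walks k m n) (four_walks k m n.+1) = r.
Proof.
move=> k_odd k_ge3 lt_n r_t; have [p q Ep Eq pq] := four_walks_step k_odd k_ge3 lt_n.
suff [m <-] : exists m, third (p m) (q m) = r.
  by exists m; congr third; [apply: Ep | apply: Eq].
case: pq => [[-> ->]|[[-> ->]|[[-> ->]|[-> ->]]]]; case: r r_t => // _;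
  first [by exists (@Ordinal 4 0 isT) | by exists (@Ordinal 4 1 isT)
        | by exists (@Ordinal 4 2 isT) | by exists (@Ordinal 4 3 isT)].
Qed.

Theorem theorem3p8 (k : nat) (k_odd : odd k) (k_ge3 : 3 <= k) :
  is_perfect_matching_index (flower_snark k) 4.
Proof.
have k_gt0 : 0 < k by lia.
have sym := @flower_snark_sym k; have irr := @flower_snark_irrefl k (ltnW k_ge3).
have ge4 C : perfect_matching_cover (flower_snark k) C -> 4 <= #|C|.
  move=> covC; rewrite ltnNge; apply/negP => le3.
  have e_t : flower_snark k (Ft, Ordinal k_gt0) (Fx, Ordinal k_gt0).
    by rewrite flower_snark_t eqxx.
  have [f [g [h [mf mg mh]]]] := cover_three_matings sym irr e_t covC le3.
  exact: three_matings_nocover.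
have cov := matings_cover sym
  (fun m => walk_mating (four_walks_walk m k_odd k_ge3))
  (walks_cover (fun m => four_walks_walk m k_odd k_ge3)
    (fun n r => @four_walks_cut k n r k_odd k_ge3)
    (fun n r => @four_walks_third k n r k_odd k_ge3)).
split; last exact: ge4.
exists [set matching_of (walk_mate (four_walks k m)) | m : 'I_4]; first exact: cov.
(* The lower bound itself shows that the four matchings are distinct. *)
apply/eqP; rewrite eqn_leq ge4 ?andbT; last exact: cov.
by rewrite (leq_trans (leq_imset_card _ _)) // card_ord.
Qed.
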